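(* Let $k \ge 1$ and let $s_1, \ldots, s_k$ be positive integers, not all equal to $1$. For $1 \le t \le k$ let $$L_t = \operatorname{lcm}\left( \prod_{i \in I} s_i \;:\; I \subseteq \{1,\ldots,k\},\ |I| = t \right),$$ and let $$d = \max\{ |I| : \emptyset \neq I \subseteq \{1,\ldots,k\},\ \gcd(s_i : i \in I) > 1 \}.$$ Then $$L_1 < L_2 < \cdots < L_d = L_{d+1} = \cdots = L_k.$$ In particular, for every $t \in \{1,\ldots,k\}$, $L_t = L_k$ if and only if $t \ge d$.
   Context: Here $|I|$ denotes the cardinality of $I$. The integers $s_1,\ldots,s_k$ are the orders (numbers of levels) of the $k$ factors of a factorial design; they need not be distinct. The number $L_t$ is the least common multiple, over all $t$-element subsets $I$ of the index set $\{1,\ldots,k\}$, of the products $\prod_{i\in I} s_i$; in particular $L_1 = \operatorname{lcm}(s_1,\ldots,s_k)$ and $L_k = s_1\cdots s_k$. The gcd of a single integer $s_i$ is $s_i$ itself, and $1 \le d \le k$. The displayed chain means $L_t < L_{t+1}$ for $1 \le t < d$ and $L_t = L_{t+1}$ for $d \le t < k$. *)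

(* Defs.v *)
From mathcomp Require Import all_boot.
Set Implicit Arguments.
Unset Strict Implicit.
Unset Printing Implicit Defensive.

(* The orders s_1, ..., s_k are a family s : 'I_k -> nat, so the index set
   {1, ..., k} is shifted to {0, ..., k-1}. *)

Definition level_lcm (k : nat) (s : 'I_k -> nat) (t : nat) : nat :=
  \big[lcmn/1]_(I : {set 'I_k} | #|I| == t) \prod_(i in I) s i.

(* 0 is the neutral element of gcdn, so the gcd of a single integer is that
   integer, and the gcd over the empty set is 0. *)
Definition subset_gcd (k : nat) (s : 'I_k -> nat) (I : {set 'I_k}) : nat :=
  \big[gcdn/0]_(i in I) s i.

(* \max over an empty range is 0; max_noncoprime_attained shows that this
   default is not used when the s i are not all equal to 1. *)
Definition max_noncoprime (k : nat) (s : 'I_k -> nat) : nat :=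
  \max_(I : {set 'I_k} | (I != set0) && (1 < subset_gcd s I)) #|I|.

Lemma max_noncoprime_attained (k : nat) (s : 'I_k -> nat)
    (s_gt0 : forall i, 0 < s i) (s_neq1 : ~ (forall i, s i = 1)) :
  exists I : {set 'I_k},
    [/\ I != set0, 1 < subset_gcd s I & #|I| = max_noncoprime s].
Proof.
have [i si] : exists i, s i != 1.
  have [/existsP//|/existsPn H] := boolP [exists i, s i != 1].
  by case: s_neq1 => i; apply/eqP; rewrite -[_ == _]negbK H.
have Pi : ([set i] != set0) && (1 < subset_gcd s [set i]).
  rewrite /subset_gcd big_set1 [1 < _]ltn_neqAle [1 == _]eq_sym si s_gt0 andbT.
  by rewrite -card_gt0 cards1.
have [|I /andP[I0 I1] E] := @eq_bigmax_cond _
  [pred I : {set 'I_k} | (I != set0) && (1 < subset_gcd s I)]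
  (fun I : {set 'I_k} => #|I|).
  by apply/card_gt0P; exists [set i].
by exists I; split.
Qed.

Lemma max_noncoprime_bounds (k : nat) (s : 'I_k -> nat)
    (s_gt0 : forall i, 0 < s i) (s_neq1 : ~ (forall i, s i = 1)) :
  1 <= max_noncoprime s <= k.
Proof.
have [I [I0 _ <-]] := max_noncoprime_attained s_gt0 s_neq1.
by rewrite card_gt0 I0 -[leqRHS]card_ord max_card.
Qed.

(* Main.v *)
(* For a prime p the p-adic valuation of L_t is the largest valuation of a
   product of t of the s_i.  When t < d, a prime dividing the gcd of d of the
   s_i divides some s_i outside any given t-set, so the valuation of L_t at
   that prime can be increased by adding one index.  When d <= t, every prime
   misses some s_j in each (t+1)-set, so dropping that j does not change the
   valuation at this prime, and L_(t+1) divides L_t. *)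

Require Import Defs.
From mathcomp Require Import all_boot.
Set Implicit Arguments.
Unset Strict Implicit.
Unset Printing Implicit Defensive.

(** Valuations turn lcm into max. Positivity matters because [logn p 0 = 0], whereas a single zero
    term makes the whole lcm zero. *)
Lemma logn_biglcm (p : nat) (I : finType) (P : pred I) (F : I -> nat) :
  (forall i, P i -> 0 < F i) ->
  logn p (\big[lcmn/1]_(i | P i) F i) = \max_(i | P i) logn p (F i).
Proof.
move=> F_gt0.
suff [] : 0 < \big[lcmn/1]_(i | P i) F i /\
          logn p (\big[lcmn/1]_(i | P i) F i) = \max_(i | P i) logn p (F i) by [].
apply: (big_rec2 (fun m n => 0 < m /\ logn p m = n)) => [|i m n Pi [n_gt0 <-]].
  by rewrite logn1.
by rewrite lcmn_gt0 F_gt0 // n_gt0 logn_lcm ?F_gt0.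
Qed.

Section LevelLcm.

Variables (k : nat) (s : 'I_k -> nat).
Hypothesis s_gt0 : forall i, 0 < s i.

Lemma prod_dvd_level_lcm (I : {set 'I_k}) :
  \prod_(i in I) s i %| level_lcm s #|I|.
Proof. exact: (biglcmn_sup I). Qed.

Lemma level_lcm_gt0 t : 0 < level_lcm s t.
Proof.
apply: (big_ind (fun m => 0 < m)) => // [m n m_gt0 n_gt0|I _].
  by rewrite lcmn_gt0 m_gt0.
by rewrite prodn_gt0.
Qed.

(** Since [t < k], every [t]-set misses some index [j], and adjoining [j] only multiplies the
    product by [s j]. *)
Lemma level_lcm_dvdS t : t < k -> level_lcm s t %| level_lcm s t.+1.
Proof.
move=> ltk; apply/dvdn_biglcmP => I /eqP cI.
have /set0Pn[j] : ~: I != set0.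
  by rewrite -card_gt0 cardsCs setCK cI card_ord subn_gt0.
rewrite inE => jI; have := prod_dvd_level_lcm (j |: I).
by rewrite cardsU1 jI cI big_setU1 //=; apply/dvdn_trans/dvdn_mull.
Qed.

Lemma dvdn_subset_gcd (m : nat) (I : {set 'I_k}) :
  reflect (forall i, i \in I -> m %| s i) (m %| subset_gcd s I).
Proof. exact: dvdn_biggcdP. Qed.

Lemma level_lcm_ltS t :
  (exists2 I : {set 'I_k}, 1 < subset_gcd s I & t < #|I|) ->
  level_lcm s t < level_lcm s t.+1.
Proof.
move=> [I gI tI].
have tk : t < k by rewrite (leq_trans tI) // -[leqRHS]card_ord max_card.
rewrite ltn_neqAle dvdn_leq ?level_lcm_gt0 ?level_lcm_dvdS // andbT.
set p := pdiv (subset_gcd s I); have p_pr : prime p by apply: pdiv_prime.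
have p_s : forall i, i \in I -> p %| s i by apply/dvdn_subset_gcd/pdiv_dvd.
(* [J] is a [t]-set whose product attains the valuation of [level_lcm s t] at [p]; the first [t]
   indices show that some [t]-set exists. *)
have [|J /eqP cJ maxJ] := @eq_bigmax_cond _
    [pred J : {set 'I_k} | #|J| == t] (fun J => logn p (\prod_(i in J) s i)).
  apply/card_gt0P; exists [set i in take t (enum 'I_k)].
  rewrite !inE cardsE (card_uniqP _) ?take_uniq ?enum_uniq //.
  by rewrite size_takel // size_enum_ord ltnW.
have logL : logn p (level_lcm s t) = logn p (\prod_(i in J) s i).
  by rewrite logn_biglcm // => *; rewrite prodn_gt0.
have /subsetPn[i iI iJ] : ~~ (I \subset J).
  by apply: contraL tI => /subset_leq_card; rewrite cJ -leqNgt.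
apply/eqP => eqL.
(* As [p] divides [s i], the product over [i |: J] has a larger valuation at [p] than
   [level_lcm s t], yet under [eqL] it divides it. *)
have := dvdn_leq_log p (level_lcm_gt0 _) (prod_dvd_level_lcm (i |: J)).
rewrite cardsU1 iJ cJ -eqL logL big_setU1 //= lognM ?prodn_gt0 //.
by rewrite -[leqRHS]add0n leq_add2r leqNgt logn_gt0 mem_primes p_pr s_gt0 p_s.
Qed.

Lemma level_lcm_eqS t : t < k ->
  (forall I : {set 'I_k}, #|I| = t.+1 -> subset_gcd s I <= 1) ->
  level_lcm s t = level_lcm s t.+1.
Proof.
move=> tk gcd1; apply/eqP; rewrite eqn_dvd level_lcm_dvdS //=.
apply/dvdn_biglcmP => I /eqP cI.
have I_gt0 : 0 < \prod_(i in I) s i by rewrite prodn_gt0.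
apply/dvdn_partP => // p; rewrite mem_primes => /andP[p_pr _].
have [j jI pj] : exists2 j, j \in I & ~~ (p %| s j).
  apply/exists_inP; apply: contraT; rewrite negb_exists_in => /forall_inP pI.
  have /set0Pn[j jI] : I != set0 by rewrite -card_gt0 cI.
  (* The bound [<= 1] alone would allow a gcd of 0, which every [p] divides; a positive [s j] with
     [j] in [I] excludes this. *)
  have g_gt0 : 0 < subset_gcd s I.
    apply: (@dvdn_gt0 _ (s j)) => //.
    by move/dvdn_subset_gcd: (dvdnn (subset_gcd s I)); apply.
  have /(dvdn_leq g_gt0) : p %| subset_gcd s I.
    by apply/dvdn_subset_gcd => i /pI; rewrite negbK.
  by rewrite leqNgt (leq_ltn_trans (gcd1 I cI)) ?prime_gt1.
have cIj : #|I :\ j| = t by move: cI; rewrite (cardsD1 j) jI => -[].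
have := prod_dvd_level_lcm (I :\ j); rewrite cIj; apply: dvdn_trans.
(* The [p]-part of [s j] is 1, so removing [j] leaves the [p]-part of the product unchanged. *)
rewrite (big_setD1 j) //= partnM ?prodn_gt0 //.
by rewrite part_p'nat ?mul1n ?dvdn_part // p'natE.
Qed.

End LevelLcm.

Theorem theorem2p1 (k : nat) (s : 'I_k -> nat)
    (k_ge1 : 1 <= k)
    (s_gt0 : forall i : 'I_k, 0 < s i)
    (s_neq1 : ~ (forall i : 'I_k, s i = 1)) :
  let L := level_lcm s in
  let d := max_noncoprime s in
  [/\ forall t : nat, 1 <= t < d -> L t < L t.+1,
      forall t : nat, d <= t < k -> L t = L t.+1
    & forall t : nat, 1 <= t <= k -> (L t = L k <-> d <= t)].
Proof.
move=> L d.
have [I [_ gI cI]] := max_noncoprime_attained s_gt0 s_neq1.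
have /andP[_ dk] : 1 <= d <= k by apply: max_noncoprime_bounds.
have ltL t : t < d -> L t < L t.+1.
  by move=> td; apply: level_lcm_ltS => //; exists I; rewrite ?cI.
have eqL t : d <= t < k -> L t = L t.+1.
  case/andP=> dt tk; apply: level_lcm_eqS => // J cJ.
  (* A set of [t.+1] indices with gcd above 1 would force [t < d]. *)
  rewrite leqNgt; apply: contraL dt => gJ; rewrite -ltnNge -cJ.
  apply: (@leq_bigmax_cond _ _ (fun J : {set 'I_k} => #|J|)).
  by rewrite gJ -card_gt0 cJ.
have leL t u : t <= u <= k -> L t <= L u.
  elim: u => [|u IHu]; first by rewrite leqn0 => /andP[/eqP->].
  rewrite leq_eqVlt => /andP[/predU1P[-> //|tu] uk].
  apply: leq_trans (IHu _) _; first by rewrite -ltnS tu ltnW.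
  by apply: dvdn_leq; [exact: level_lcm_gt0 | exact: level_lcm_dvdS].
split=> [t /andP[_]|//|t /andP[_ tk]]; first exact: ltL.
split=> [Ltk|dt].
  (* If [t < d], then [L t < L t.+1 <= L k], against [L t = L k]. *)
  rewrite leqNgt; apply/negP => td.
  have tkS : t < k <= k by rewrite (leq_trans td dk) leqnn.
  by have := leq_trans (ltL t td) (leL _ _ tkS); rewrite Ltk ltnn.
suff Eu u : t <= u <= k -> L t = L u by apply: Eu; rewrite tk leqnn.
elim: u => [|u IHu]; first by rewrite leqn0 => /andP[/eqP->].
rewrite leq_eqVlt => /andP[/predU1P[-> //|tu] uk].
have tuk : t <= u <= k by rewrite -ltnS tu ltnW.
by rewrite (IHu tuk) eqL // uk (leq_trans dt).
Qed.
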